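(* Let $X, Y$ be metric spaces, let $s, r_1, r_2$ be positive real numbers and let $f, g : X \to Y$ be two $s$-Lipschitz maps. If $r_1 \le r_2$, then $D^{(s)}_{r_2}(f,g) \le D^{(s)}_{r_1}(f,g)$.
   Context: For a non-negative integer $m$, $[m] = \{0, 1, \dots, m\}$ carries the metric $d(a,b) = |a-b|$. For $s \ge 0$, a map $\varphi$ between metric spaces is $s$-Lipschitz if $d(\varphi(x), \varphi(x')) \le s\, d(x,x')$ for all $x,x'$. For maps $f, g : X \to Y$ between metric spaces, an $(s,r)$-homotopy between $f$ and $g$ is a map $F : X \times [m] \to Y$, for some non-negative integer $m$, such that (1) $F(x,-) : [m] \to Y$ is $r$-Lipschitz for every $x \in X$; (2) $F(-,i) : X \to Y$ is $s$-Lipschitz for every $i \in [m]$; (3) $F(x,0) = f(x)$ and $F(x,m) = g(x)$ for all $x \in X$. One writes $f \simeq_{(s,r)} g$ if such an $F$ exists. For two $s$-Lipschitz maps $f,g : X \to Y$, the discrete homotopic distance $D^{(s)}_r(f,g)$ is the smallest integer $k \ge 0$ for which there is an open cover $U_0, \dots, U_k$ of $X$ with $f|_{U_i} \simeq_{(s,r)} g|_{U_i}$ (as maps $U_i \to Y$) for all $i = 0, \dots, k$; it is $\infty$ if no such cover exists. *)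

(* Defs.v *)
From HB Require Import structures.
From mathcomp Require Import all_boot all_order all_algebra.
From mathcomp Require Import all_classical all_reals all_analysis.

Set Implicit Arguments.
Unset Strict Implicit.
Unset Printing Implicit Defensive.

Import Order.TTheory GRing.Theory Num.Theory.

Local Open Scope classical_set_scope.
Local Open Scope ring_scope.

(* The library equips the type of a set with the pseudometric whose balls are
   the traces of the ambient balls; its distance is the restricted distance. *)
Section subset_metric.
Context {R : realType} {X : metricType R} (A : set X).

Let dist (x y : A) : R := mdist (set_val x) (set_val y).

Let dist_ge0 x y : 0 <= dist x y.
Proof. exact: mdist_ge0. Qed.

Let dist_positivity x y : dist x y = 0 -> x = y.
Proof. by move=> /mdist_positivity/val_inj. Qed.

Let ballEdist (x : A) (e : R) : ball x e = [set y | dist x y < e].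
Proof.
rewrite -[LHS]/[set y | ball (set_val x) e (set_val y)].
by rewrite ballEmdist.
Qed.

HB.instance Definition _ := @PseudoMetric_isMetric.Build R (set_type A)
  dist dist_ge0 dist_positivity ballEdist.

End subset_metric.

(* The discrete interval {0, ..., m}. The parameter [R] is there only for the
   canonical structure, since the distance takes its values in [R]. *)
Definition dinterval (R : realType) (m : nat) : Type := 'I_m.+1.

HB.instance Definition _ (R : realType) (m : nat) :=
  Choice.copy (dinterval R m) 'I_m.+1.

Section dinterval_metric.
Context (R : realType) (m : nat).

Let dist (a b : dinterval R m) : R :=
  `|(a : 'I_m.+1)%:R - (b : 'I_m.+1)%:R|.

Let distxx a : dist a a = 0.
Proof. by rewrite /dist subrr normr0. Qed.

Let dist_positivity a b : dist a b = 0 -> a = b.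
Proof.
move=> /normr0_eq0/eqP; rewrite subr_eq0 eqr_nat => /eqP ab.
exact: (@ord_inj m.+1).
Qed.

Let dist_sym a b : dist a b = dist b a.
Proof. exact: distrC. Qed.

Let dist_triangle b a c : dist a c <= dist a b + dist b c.
Proof. exact: ler_distD. Qed.

HB.instance Definition _ := @isMetric.Build R (dinterval R m)
  dist distxx dist_positivity dist_sym dist_triangle.

End dinterval_metric.

Section discrete_homotopy.
Context {R : realType}.

Definition slipschitz (X Y : metricType R) (s : R) (f : X -> Y) : Prop :=
  forall x x' : X, mdist (f x) (f x') <= s * mdist x x'.

Definition is_homotopy (X Y : metricType R) (s r : R) (f g : X -> Y) (m : nat)
    (F : X * dinterval R m -> Y) : Prop :=
  [/\ forall x : X, slipschitz r (fun i : dinterval R m => F (x, i)),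
      forall i : dinterval R m, slipschitz s (fun x : X => F (x, i)),
      forall x : X, F (x, ord0) = f x &
      forall x : X, F (x, ord_max) = g x].

Definition homotopic (X Y : metricType R) (s r : R) (f g : X -> Y) : Prop :=
  exists m : nat, exists F : X * dinterval R m -> Y, is_homotopy s r f g F.

Definition has_homotopic_cover (X Y : metricType R) (s r : R) (f g : X -> Y)
    (k : nat) : Prop :=
  exists U : 'I_k.+1 -> set X,
    [/\ forall i, open (U i),
        \bigcup_i U i = [set: X] &
        forall i, homotopic s r (sigL (U i) f) (sigL (U i) g)].

Definition homotopic_distance (X Y : metricType R) (s r : R) (f g : X -> Y) :
    \bar R :=
  match pselect (exists k, `[< has_homotopic_cover s r f g k >]) with
  | left exk => (ex_minn exk)%:R%:E
  | right _ => +oo%E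
  end.

End discrete_homotopy.

(* Main.v *)
Require Import Defs.
From mathcomp Require Import all_boot all_order all_algebra.
From mathcomp Require Import all_classical all_reals all_analysis.

(** An [(s,r1)]-homotopy is also an [(s,r2)]-homotopy as soon as [r1 <= r2]:
    the parameter [r] only bounds the speed of the paths [F (x, -)], and
    distances are nonnegative, so enlarging [r] weakens that bound
    ([slipschitzW], [homotopicW]). Hence every open cover that competes in the
    minimum for [r1] also competes in the minimum for [r2], and a minimum over
    a larger set of integers is smaller, with [+oo] for the empty set
    ([le_homotopic_distance]). *)

Import Order.TTheory GRing.Theory Num.Theory.

Local Open Scope ring_scope.

Lemma slipschitzW (R : realType) (X Y : metricType R) (r1 r2 : R)
    (f : X -> Y) :
  r1 <= r2 -> slipschitz r1 f -> slipschitz r2 f.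
Proof.
move=> r12 f_lip x x'; apply: le_trans (f_lip x x') _.
by rewrite ler_wpM2r// mdist_ge0.
Qed.

Lemma homotopicW (R : realType) (X Y : metricType R) (s r1 r2 : R)
    (f g : X -> Y) :
  r1 <= r2 -> homotopic s r1 f g -> homotopic s r2 f g.
Proof.
move=> r12 [m [F [F_path F_slice F0 Fm]]]; exists m, F; split=> // x.
exact: slipschitzW r12 (F_path x).
Qed.

Lemma has_homotopic_coverW (R : realType) (X Y : metricType R) (s r1 r2 : R)
    (f g : X -> Y) (k : nat) :
  r1 <= r2 -> has_homotopic_cover s r1 f g k -> has_homotopic_cover s r2 f g k.
Proof.
move=> r12 [U [U_open U_cover U_htpy]]; exists U; split=> // i.
exact: homotopicW r12 (U_htpy i).
Qed.

(** A homotopic distance depends only on the set of integers [k] for which an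
    admissible cover by [k + 1] open sets exists, and it is antitone in that
    set: if the smaller set is empty the bound is [+oo], otherwise its minimum
    also lies in the larger one. *)
Lemma le_homotopic_distance (R : realType) (X Y X' Y' : metricType R)
    (s r s' r' : R) (f g : X -> Y) (f' g' : X' -> Y') :
  (forall k, has_homotopic_cover s r f g k ->
             has_homotopic_cover s' r' f' g' k) ->
  (homotopic_distance s' r' f' g' <= homotopic_distance s r f g)%E.
Proof.
move=> sub; rewrite /homotopic_distance.
case: (pselect (exists k, `[< has_homotopic_cover s r f g k >]));
  last by move=> _; rewrite leey.
move=> exk; case: pselect => [exk'|nexk']; last first.
  by case: nexk'; have [k /asboolP /sub cov] := exk; exists k; apply/asboolP.
case: (ex_minnP exk) => k /asboolP /sub cov _.
case: (ex_minnP exk') => k' _ min_k'.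
by rewrite lee_fin ler_nat; apply: min_k'; apply/asboolP.
Qed.

Theorem proposition2p6 (R : realType) (X Y : metricType R) (s r1 r2 : R)
    (f g : X -> Y) (s_gt0 : 0 < s) (r1_gt0 : 0 < r1) (r2_gt0 : 0 < r2)
    (f_lip : slipschitz s f) (g_lip : slipschitz s g) (r12 : r1 <= r2) :
  (homotopic_distance s r2 f g <= homotopic_distance s r1 f g)%E.
Proof.
by apply: le_homotopic_distance => k; apply: has_homotopic_coverW.
Qed.
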